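(* Let $p$ be a prime and let $x\in p\mathbb{Z}_p\setminus F$ be a point for which the Lyapunov exponent $\lambda_p(x)$ exists. Then $$\lambda_p(x)=-\lim_{n\to\infty}\frac1n\log\left|x-\frac{p_n(x)}{q_n(x)}\right|_p .$$
   Context: $\log$ is the natural logarithm. $\mathbb{Q}_p$ is the field of $p$-adic numbers with valuation $v_p$ and absolute value $|x|_p=p^{-v_p(x)}$, and $p\mathbb{Z}_p=\{x\in\mathbb{Q}_p:|x|_p<1\}$. The Schneider map $T_p:p\mathbb{Z}_p\to p\mathbb{Z}_p$ is $T_p(0)=0$ and, for $x\ne0$, $T_p(x)=\frac{p^{a_1(x)}}{x}-b_1(x)$, where $a_1(x)=v_p(x)$ and $b_1(x)\in\{1,\dots,p-1\}$ is determined by $b_1(x)\equiv p^{a_1(x)}/x \pmod p$. Let $F=\bigcup_{k\ge0}T_p^{-k}(0)$, and for $x\in p\mathbb{Z}_p\setminus F$, $i\ge1$, let $a_i(x)=a_1(T_p^{i-1}x)$, $b_i(x)=b_1(T_p^{i-1}x)$. The Lyapunov exponent is $\lambda_p(x)=\lim_{n\to\infty}\log p\cdot\frac{a_1(x)+\cdots+a_n(x)}{n}$ whenever this limit exists. The $n$-th rational approximation of $x$ is $$\frac{p_n(x)}{q_n(x)}=\cfrac{p^{a_1(x)}}{b_1(x)+\cfrac{p^{a_2(x)}}{b_2(x)+\cdots+\cfrac{p^{a_n(x)}}{b_n(x)}}}.$$ *)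

(* Defs.v *)
From HB Require Import structures.
From mathcomp Require Import all_boot all_order all_algebra.
From mathcomp Require Import all_classical all_reals all_analysis.

Set Implicit Arguments.
Unset Strict Implicit.
Unset Printing Implicit Defensive.

Import Order.TTheory GRing.Theory Num.Theory.

(* Z_p as the inverse limit of the rings Z/p^n.  The class at level n is      *)
(* stored as its least residue: the coherence condition at n also forces      *)
(* padic_res n < p ^ n.  Primality is a parameter of the type so that the     *)
(* integral domain structure below can be inferred.                           *)
Record padic_int (p : nat) (p_pr : prime p) := PadicInt {
  padic_res :> nat -> nat;
  padic_resP : forall n, padic_res n = padic_res n.+1 %% p ^ n
}.

Section PadicInt.
Local Open Scope nat_scope.
Variables (p : nat) (p_pr : prime p).
Local Notation Zp := (padic_int p_pr).
Implicit Types x y z : Zp.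

HB.instance Definition _ := gen_eqMixin Zp.
HB.instance Definition _ := gen_choiceMixin Zp.

Lemma padic_int_ext x y : (forall n, x n = y n) -> x = y.
Proof.
case: x y => [f hf] [g hg] /= /funext fg; rewrite -{}fg in hg *.
by congr PadicInt; exact: Prop_irrelevance.
Qed.

Lemma padic_res_modn x n : x n %% p ^ n = x n.
Proof. by rewrite [in LHS]padic_resP modn_mod -padic_resP. Qed.

Lemma padic_res_le x m n : m <= n -> x n %% p ^ m = x m.
Proof.
move=> /subnK <-; elim: (n - m) => [|k IH]; first exact: padic_res_modn.
by rewrite -IH [x (k + m)]padic_resP modn_dvdm ?dvdn_exp2l ?leq_addl.
Qed.

Lemma padic_coherent (f : nat -> nat) :
    (forall n, f n = f n.+1 %[mod p ^ n]) ->
  forall n, f n %% p ^ n = (f n.+1 %% p ^ n.+1) %% p ^ n.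
Proof. by move=> fP n; rewrite modn_dvdm ?dvdn_exp2l // fP. Qed.

Definition padic_mk (f : nat -> nat) (fP : forall n, f n = f n.+1 %[mod p ^ n]) :
  Zp := @PadicInt p p_pr (fun n => f n %% p ^ n) (padic_coherent fP).

Lemma padic_res_eqmod x n : x n = x n.+1 %[mod p ^ n].
Proof. by rewrite padic_res_modn -padic_resP. Qed.

Lemma padic_const_subproof (c n : nat) : c = c %[mod p ^ n].
Proof. by []. Qed.

Lemma padic_add_subproof x y n : x n + y n = x n.+1 + y n.+1 %[mod p ^ n].
Proof. by rewrite -modnDm padic_res_eqmod (padic_res_eqmod y) modnDm. Qed.

Lemma padic_mul_subproof x y n : x n * y n = x n.+1 * y n.+1 %[mod p ^ n].
Proof. by rewrite -modnMm padic_res_eqmod (padic_res_eqmod y) modnMm. Qed.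

Lemma padic_opp_subproof x n :
  (p ^ n).-1 * x n = (p ^ n.+1).-1 * x n.+1 %[mod p ^ n].
Proof.
have pn k : 0 < p ^ k by rewrite expn_gt0 prime_gt0.
apply/eqP; rewrite -(eqn_modDr (x n)) -mulSnr prednK // modnMr.
rewrite -modnDmr padic_res_eqmod modnDmr -mulSnr prednK //.
by rewrite expnS mulnAC modnMl.
Qed.

Definition padic_zero : Zp := padic_mk (padic_const_subproof 0).
Definition padic_one : Zp := padic_mk (padic_const_subproof 1).
Definition padic_add x y : Zp := padic_mk (padic_add_subproof x y).
Definition padic_mul x y : Zp := padic_mk (padic_mul_subproof x y).
(* (p ^ n - 1) * x n represents - x n modulo p ^ n. *)
Definition padic_opp x : Zp := padic_mk (padic_opp_subproof x).

Lemma padic_addA : associative padic_add.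
Proof.
by move=> x y z; apply: padic_int_ext => n /=; rewrite modnDml modnDmr addnA.
Qed.

Lemma padic_addC : commutative padic_add.
Proof. by move=> x y; apply: padic_int_ext => n /=; rewrite addnC. Qed.

Lemma padic_add0 : left_id padic_zero padic_add.
Proof.
by move=> x; apply: padic_int_ext => n /=; rewrite mod0n padic_res_modn.
Qed.

Lemma padic_addN : left_inverse padic_zero padic_opp padic_add.
Proof.
move=> x; apply: padic_int_ext => n /=.
by rewrite modnDml -mulSnr prednK ?expn_gt0 ?prime_gt0// modnMr mod0n.
Qed.

Lemma padic_mulA : associative padic_mul.
Proof.
by move=> x y z; apply: padic_int_ext => n /=; rewrite modnMml modnMmr mulnA.
Qed.

Lemma padic_mulC : commutative padic_mul.
Proof. by move=> x y; apply: padic_int_ext => n /=; rewrite mulnC. Qed.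

Lemma padic_mul1 : left_id padic_one padic_mul.
Proof.
by move=> x; apply: padic_int_ext => n /=; rewrite modnMml mul1n padic_res_modn.
Qed.

Lemma padic_mulDl : left_distributive padic_mul padic_add.
Proof.
move=> x y z; apply: padic_int_ext => n /=.
by rewrite modnMml modnDm mulnDl.
Qed.

Lemma padic_one_neq0 : padic_one != padic_zero.
Proof.
apply/eqP => /(congr1 (fun x : Zp => x 1)) /=.
by rewrite expn1 mod0n modn_small ?prime_gt1.
Qed.

HB.instance Definition _ :=
  GRing.isZmodule.Build Zp padic_addA padic_addC padic_add0 padic_addN.
HB.instance Definition _ :=
  GRing.Zmodule_isComNzRing.Build Zp
    padic_mulA padic_mulC padic_mul1 padic_mulDl padic_one_neq0.

Local Open Scope ring_scope.

Definition padic_unit : {pred Zp} := [pred x | `[< exists y, y * x = 1 >]].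
Definition padic_inv x : Zp :=
  if pselect (exists y, y * x = 1) is left ex then projT1 (cid ex) else x.

Lemma padic_mulVx : {in padic_unit, left_inverse 1 padic_inv *%R}.
Proof.
move=> x /asboolP ex; rewrite /padic_inv; case: pselect => // ex'.
exact: (projT2 (cid ex')).
Qed.

Lemma padic_unitP x y : y * x = 1 -> padic_unit x.
Proof. by move=> yx; apply/asboolP; exists y. Qed.

Lemma padic_inv_out : {in [predC padic_unit], padic_inv =1 id}.
Proof.
move=> x; rewrite !inE => /asboolPn nex.
by rewrite /padic_inv; case: pselect.
Qed.

HB.instance Definition _ :=
  GRing.ComNzRing_hasMulInverse.Build Zp padic_mulVx padic_unitP padic_inv_out.

Lemma padic_neq0 x : x != 0 ->
  exists n, forall m, (0 < x (n + m))%N && (logn p (x (n + m)) < n)%N.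
Proof.
move=> x0; have [n xn] : exists n, x n <> 0%N.
  apply: contrapT => /forallNP xn; move/eqP: x0; apply; apply: padic_int_ext.
  by move=> n /=; rewrite mod0n; apply: contrapT; exact: xn.
exists n => m; have := padic_res_le x (leq_addr m n); move: (x (n + m)%N) => k kE.
have k0 : (0 < k)%N by case: k kE => // kE; case: xn; rewrite -kE mod0n.
rewrite k0 /= ltnNge -pfactor_dvdn //; apply/negP => /eqP dv.
by apply: xn; rewrite -kE.
Qed.

Lemma padic_mulf_eq0 : GRing.integral_domain_axiom Zp.
Proof.
move=> x y xy; apply: contrapT => /negP; rewrite negb_or => /andP[].
move=> /padic_neq0[m xm] /padic_neq0[n yn].
have /andP[x0 lx] := xm n; have /andP[] := yn m; rewrite addnC => y0 ly.
have /eqP : (x * y : Zp) (m + n)%N = 0%N by rewrite xy /= mod0n.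
rewrite -/(dvdn _ _) pfactor_dvdn ?muln_gt0 ?x0 // lognM //.
by rewrite leqNgt -addSn leq_add // ltnW.
Qed.

HB.instance Definition _ :=
  GRing.ComUnitRing_isIntegral.Build Zp padic_mulf_eq0.

End PadicInt.

Local Open Scope classical_set_scope.
Local Open Scope ring_scope.

Definition padic (p : nat) (p_pr : prime p) := {fraction (padic_int p_pr)}.

Section Padic.
Variables (p : nat) (p_pr : prime p).
Local Notation Qp := (padic p_pr).
Implicit Types x : Qp.

HB.instance Definition _ := GRing.Field.on Qp.

(* The exponent k in x = p ^ k * u with u a unit of Z_p; junk value 0 at 0. *)
Definition padic_val x : int :=
  xget 0 [set k : int | exists2 u : padic_int p_pr,
                          u \is a GRing.unit & x = p%:R ^ k * tofrac u].

(* Rational-valued; cast to the reals with ratr where logarithms are taken. *)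
Definition padic_abs x : rat := if x == 0 then 0 else p%:R ^ (- padic_val x).

Definition pZp : set Qp := [set x | padic_abs x < 1].

Definition schneider_a1 x : int := padic_val x.

Definition schneider_b1 x : nat :=
  xget 0%N [set b : nat |
    (1 <= b <= p.-1)%N /\ pZp (b%:R - p%:R ^ schneider_a1 x / x)].

(* Total on Q_p, meaningful on pZp. *)
Definition schneider x : Qp :=
  if x == 0 then 0 else p%:R ^ schneider_a1 x / x - (schneider_b1 x)%:R.

Definition schneider_F : set Qp :=
  pZp `&` \bigcup_k (iter k schneider @^-1` [set 0]).

(* Indexed from i = 1. *)
Definition schneider_a x (i : nat) : int := schneider_a1 (iter i.-1 schneider x).
Definition schneider_b x (i : nat) : nat := schneider_b1 (iter i.-1 schneider x).

(* The m-level continued fraction with digits i, i + 1, ..., i + m - 1. *)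
Fixpoint schneider_frac x (i m : nat) : Qp :=
  if m is m'.+1 then
    p%:R ^ schneider_a x i / ((schneider_b x i)%:R + schneider_frac x i.+1 m')
  else 0.

(* p_n(x) / q_n(x) *)
Definition schneider_approx x (n : nat) : Qp := schneider_frac x 1 n.

Variable R : realType.

Definition lyapunov_seq x (n : nat) : R :=
  ln p%:R * ((\sum_(1 <= i < n.+1) schneider_a x i)%:~R / n%:R).

(* Limits are taken in the extended reals, so that the value +oo is allowed. *)
Definition has_lyapunov x : Prop := cvgn (fun n => (lyapunov_seq x n)%:E).
Definition lyapunov x : \bar R := limn (fun n => (lyapunov_seq x n)%:E).

End Padic.

Arguments pZp {p} p_pr _.
Arguments schneider_F {p} p_pr _.

(* Main.v *)
Require Import Defs.
From mathcomp Require Import all_boot all_order all_algebra.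
From mathcomp Require Import all_classical all_reals all_analysis.
From mathcomp Require Import ring.
From mathcomp Require cyclic.
Set Implicit Arguments.
Unset Strict Implicit.
Unset Printing Implicit Defensive.

Import Order.TTheory GRing.Theory Num.Theory.
Local Open Scope classical_set_scope.
Local Open Scope ring_scope.

(** The approximation error is known exactly.  Write x_i for the i-th iterate
    of x under the Schneider map T and f_i for the m-level continued fraction
    built from the digits of x_i.  By definition of T,

      x_i = p ^ a / (b + x_(i+1))   and   f_i = p ^ a / (b + f_(i+1))

    with the same a and b, where f_(i+1) has m - 1 levels.  Hence

      x_i - f_i = - p ^ a (x_(i+1) - f_(i+1)) / ((b + x_(i+1)) (b + f_(i+1))),

    and both factors of the denominator are p-adic units, since b is a nonzero
    digit and x_(i+1), f_(i+1) lie in p Z_p.  So each level multiplies the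
    error by p ^ a up to a unit, and the last one leaves x_n - 0, of valuation
    a_(n+1).  Therefore [schneider_frac_err]

      v_p (x - p_n / q_n) = a_1 + ... + a_n + a_(n+1).

    Consequently 1/n log |x - p_n / q_n|_p = - (n+1)/n * L_(n+1), where L_n is
    the n-th term of the sequence defining the Lyapunov exponent.  The index
    shift and the factor (n+1)/n -> 1 do not affect the limit, be it finite or
    +oo.

    The valuation is handled through the predicate [has_padic_val], which is
    compatible with products and inverses.  Its totality on nonzero elements
    [has_padic_val_ex] and the identification of the open unit ball with p Z_p
    [pZpP] rest on the description of the units of Z_p as the elements with
    nonzero residue modulo p [padic_int_unitE]. *)

(** * Units and factorization in Z_p *)

Section PadicIntegers.
Context {p : nat} {p_pr : prime p}.
Local Notation Zp := (padic_int p_pr).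
Implicit Types (y z : Zp).

Lemma padic_resB0 y z n : y n = z n -> (y - z) n = 0%N.
Proof.
move=> yz; have -> : (y - z) n =
  ((y n + ((p ^ n).-1 * z n) %% p ^ n) %% p ^ n)%N by [].
by rewrite yz modnDmr -mulSn prednK ?expn_gt0 ?prime_gt0// modnMr.
Qed.

Lemma padic_res_nat (b n : nat) : (b%:R : Zp) n = (b %% p ^ n)%N.
Proof.
elim: b => [|b IH] //; rewrite -natr1.
have -> : (b%:R + 1 : Zp) n = (((b%:R : Zp) n + 1 %% p ^ n) %% p ^ n)%N by [].
by rewrite IH modnDm addn1.
Qed.

Lemma padic_res0 z : z 0%N = 0%N.
Proof. by rewrite -padic_res_modn expn0 modn1. Qed.

Lemma padic_res_ltn z n : (z n < p ^ n)%N.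
Proof. by rewrite -padic_res_modn ltn_pmod// expn_gt0 prime_gt0. Qed.

Lemma padic_res1_dvd z n : z 1%N = 0%N -> (p %| z n)%N.
Proof.
case: n => [|n] z1; first by rewrite padic_res0.
by rewrite /dvdn -[X in (_ %% X)%N]expn1 padic_res_le// z1.
Qed.

(** The quotient of z by p loses one digit of precision: its class modulo
    p ^ n is read off the class of z modulo p ^ (n + 1). *)
Lemma padic_res1_divp z : z 1%N = 0%N ->
  exists2 w, z = p%:R * w & forall n, w n = (z n.+1 %/ p)%N.
Proof.
move=> z1; have p0 := prime_gt0 p_pr.
have zK n : ((z n %/ p) * p)%N = z n by rewrite divnK// padic_res1_dvd.
have wP n : (z n.+1 %/ p = z n.+2 %/ p %[mod p ^ n])%N.
  apply/eqP; rewrite -(eqn_pmul2r p0) !muln_modl !zK -expnSr; apply/eqP.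
  exact: padic_res_eqmod.
have wE n : padic_mk p_pr wP n = (z n.+1 %/ p)%N.
  by rewrite /= modn_small// ltn_divLR// -expnSr padic_res_ltn.
exists (padic_mk p_pr wP) => //; apply: padic_int_ext => n.
have -> : (p%:R * padic_mk p_pr wP : Zp) n =
  ((p%:R : Zp) n * padic_mk p_pr wP n %% p ^ n)%N by [].
by rewrite wE padic_res_nat modnMml mulnC zK padic_res_le.
Qed.

(** If z is nonzero modulo p, then it is prime to p ^ n at each level, where
    Euler's theorem makes z ^ (phi (p ^ n) - 1) an inverse of z; these are
    coherent by uniqueness of inverses. *)
Lemma padic_int_unitE z : (z \is a GRing.unit) = (z 1%N != 0%N).
Proof.
apply/idP/idP => [zu|z1].
  apply/eqP => z1; have /(congr1 (fun y : Zp => y 1%N)) := mulVr zu.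
  have -> : (z^-1 * z) 1%N = ((z^-1)%R 1%N * z 1%N %% p ^ 1)%N by [].
  by rewrite z1 muln0 mod0n /= modn_small// expn1 prime_gt1.
have cop n : coprime (z n) (p ^ n).
  case: n => [|n]; first by rewrite expn0 coprimen1.
  rewrite coprime_pexpr// coprime_sym prime_coprime//.
  by rewrite /dvdn -[X in (_ %% X)%N]expn1 padic_res_le.
pose f n := (z n ^ (totient (p ^ n)).-1)%N.
have fz n : (f n * z n = 1 %[mod p ^ n])%N.
  rewrite -expnSr prednK ?totient_gt0 ?expn_gt0 ?prime_gt0//.
  by rewrite cyclic.Euler_exp_totient.
have fP n : (f n = f n.+1 %[mod p ^ n])%N.
  have fz' : (f n.+1 * z n = 1 %[mod p ^ n])%N.
    rewrite -modnMmr padic_res_eqmod modnMmr.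
    rewrite -(modn_dvdm _ (dvdn_exp2l p (leqnSn n))) fz.
    by rewrite modn_dvdm// dvdn_exp2l.
  rewrite -[f n in LHS]muln1 -modnMmr -fz' modnMmr mulnCA.
  by rewrite -modnMmr fz modnMmr muln1.
apply/unitrPr; exists (padic_mk p_pr fP); apply: padic_int_ext => n.
have -> : (z * padic_mk p_pr fP) n = (z n * (f n %% p ^ n) %% p ^ n)%N by [].
by rewrite modnMmr mulnC fz.
Qed.

(** Induction on a level at which z has a nonzero residue: dividing by p lowers
    this level by one, and at level one z is a unit. *)
Lemma padic_int_decomp z : z != 0 ->
  exists k, exists2 u : Zp, u \is a GRing.unit & z = p%:R ^+ k * u.
Proof.
move=> z0; have [n zn] : exists n, z n != 0%N.
  apply: contrapT => /forallNP zn; move/eqP: z0; apply; apply: padic_int_ext.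
  by move=> n /=; rewrite mod0n; apply/eqP/negPn/negP; exact: zn.
elim: n z zn {z0} => [z|n IH z zn]; first by rewrite padic_res0.
have [z1|z1] := eqVneq (z 1%N) 0%N; last first.
  by exists 0%N; exists z; rewrite ?padic_int_unitE// mul1r.
have [w zE wE] := padic_res1_divp z1.
have [|k [u uu wu]] := IH w.
  rewrite wE -lt0n divn_gt0 ?prime_gt0// dvdn_leq ?lt0n//.
  exact: padic_res1_dvd.
by exists k.+1; exists u => //; rewrite zE wu exprS mulrA.
Qed.

End PadicIntegers.

(** * The valuation on Q_p *)

Lemma fraction_ex (D : idomainType) (x : {fraction D}) :
  exists a b : D, b != 0 /\ x = FracField.tofrac a / FracField.tofrac b.
Proof.
elim/quotW: x => r; exists (frac r).1; exists (frac r).2; split.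
  exact: denom_ratioP.
have b0 : FracField.tofrac (frac r).2 != 0 by rewrite tofrac_eq0 denom_ratioP.
apply: (mulIf b0); rewrite divfK//; unlock FracField.tofrac.
rewrite -[LHS]FracField.pi_mul /FracField.mulf /= !numden_Ratio ?oner_neq0// mulr1.
apply/eqP; rewrite FracField.equivf_def !numden_Ratio ?oner_neq0 ?denom_ratioP//.
by rewrite mulr1 mulrC.
Qed.

Section PadicValuation.
Context {p : nat} {p_pr : prime p}.
Local Notation Zp := (padic_int p_pr).
Local Notation Qp := (padic p_pr).
Local Notation tofrac := (@FracField.tofrac Zp).
Implicit Types (x y : Qp) (k l : int).

(** A relational form of the valuation: it avoids the arbitrary value at 0,
    so that products and inverses obey the expected rules with no side
    condition. *)
Definition has_padic_val x k :=
  exists2 u : Zp, u \is a GRing.unit & x = p%:R ^ k * tofrac u.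

Lemma padic_p_neq0 : p%:R != 0 :> Qp.
Proof.
rewrite -(rmorph_nat tofrac) tofrac_eq0; apply/eqP.
(* p vanishes modulo p but not modulo p ^ 2. *)
move=> /(congr1 (fun y : Zp => y 2%N)); rewrite padic_res_nat /= mod0n.
rewrite modn_small; first by move=> p0; move: p_pr; rewrite p0.
by rewrite -[X in (X < _)%N]expn1 ltn_exp2l// prime_gt1.
Qed.

Lemma tofrac_unit_neq0 (u : Zp) : u \is a GRing.unit -> tofrac u != 0.
Proof.
by move=> uu; rewrite tofrac_eq0; apply: contraTneq uu => ->; rewrite unitr0.
Qed.

Lemma has_padic_val_neq0 x k : has_padic_val x k -> x != 0.
Proof.
by move=> [u uu ->]; rewrite mulf_neq0 ?tofrac_unit_neq0// expfz_neq0// padic_p_neq0.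
Qed.

Lemma has_padic_valX k : has_padic_val (p%:R ^ k) k.
Proof. by exists 1; rewrite ?unitr1// rmorph1 mulr1. Qed.

Lemma has_padic_valN x k : has_padic_val x k -> has_padic_val (- x) k.
Proof. by move=> [u uu ->]; exists (- u); rewrite ?unitrN// rmorphN mulrN. Qed.

Lemma has_padic_valM x y k l :
  has_padic_val x k -> has_padic_val y l -> has_padic_val (x * y) (k + l).
Proof.
move=> [u uu ->] [v vu ->]; exists (u * v); first by rewrite unitrM uu vu.
by rewrite expfzDr ?padic_p_neq0// rmorphM mulrACA.
Qed.

Lemma has_padic_valV x k : has_padic_val x k -> has_padic_val x^-1 (- k).
Proof.
move=> [u uu ->]; exists u^-1; first by rewrite unitrV.
rewrite invfM invr_expz; congr (_ * _).
apply: (mulfI (tofrac_unit_neq0 uu)).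
by rewrite divff ?tofrac_unit_neq0// -rmorphM divrr// rmorph1.
Qed.

Lemma has_padic_val_ex x : x != 0 -> exists k, has_padic_val x k.
Proof.
have tofrac_val (z : Zp) : z != 0 -> exists k, has_padic_val (tofrac z) k.
  move=> /padic_int_decomp[k [u uu ->]]; exists k%:Z; exists u => //.
  by rewrite rmorphM rmorphXn rmorph_nat.
have [a [b [b0 ->]]] := fraction_ex x.
rewrite mulf_eq0 negb_or invr_eq0 !tofrac_eq0 => /andP[/tofrac_val[k ak] /tofrac_val[l bl]].
by exists (k - l); exact/has_padic_valM/has_padic_valV.
Qed.

(** The quotient of two expressions of x gives 1 = p ^ (k - l) * u with u a
    unit, which is impossible for k > l because p is not a unit. *)
Lemma has_padic_val_inj x k l : has_padic_val x k -> has_padic_val x l -> k = l.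
Proof.
wlog lekl : k l / l <= k => [th xk xl|].
  by have [/th->//|/ltW/th->] := leP l k.
move=> /has_padic_valM xk /has_padic_valV/xk{xk}.
have -> : k - l = `|k - l|%N :> int by rewrite gez0_abs// subr_ge0.
case E : `|k - l|%N => [|n];
  first by move=> _; apply/eqP; rewrite -subr_eq0 -absz_eq0 E.
have [->|x0] := eqVneq x 0; first by rewrite mul0r => /has_padic_val_neq0/eqP.
rewrite divff// => -[u uu] /eqP.
rewrite -exprnP -(rmorph_nat tofrac) -rmorphXn -rmorphM -(rmorph1 tofrac) tofrac_eq.
move=> /eqP /(congr1 (fun z : Zp => z \is a GRing.unit)).
by rewrite unitr1 unitrM uu andbT unitrX_pos// padic_int_unitE padic_res_nat expn1 modnn.
Qed.

Lemma padic_valE x k : has_padic_val x k -> padic_val x = k.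
Proof.
move=> xk; apply: (@has_padic_val_inj x) => //.
by rewrite /padic_val; case: xgetP => [l _ //|] /(_ k).
Qed.

Lemma padic_absE x k : has_padic_val x k -> padic_abs x = p%:R ^ (- k).
Proof.
move=> xk.
by rewrite /padic_abs (negbTE (has_padic_val_neq0 xk)) (padic_valE xk).
Qed.

Lemma pZp_val x k : has_padic_val x k -> pZp p_pr x <-> 0 < k.
Proof.
move=> xk; rewrite /pZp /= (padic_absE xk) -(expr0z (p%:R : rat)).
by rewrite ltr_eXz2l ?ltr1n ?prime_gt1// oppr_lt0.
Qed.

(** This form makes the open unit ball visibly stable under addition and
    reduces congruences modulo p in Q_p to residues in Z_p. *)
Lemma pZpP x : pZp p_pr x <-> exists z : Zp, x = p%:R * tofrac z.
Proof.
have [->|x0] := eqVneq x 0.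
  split=> [_|_]; first by exists 0; rewrite rmorph0 mulr0.
  by rewrite /pZp /= /padic_abs eqxx.
have [k xk] := has_padic_val_ex x0; rewrite (pZp_val xk); split.
  case: k xk => // -[|k] // [u uu ->] _.
  by exists (p%:R ^+ k * u); rewrite rmorphM rmorphXn rmorph_nat mulrA -exprS.
move=> [z xE]; have z0 : tofrac z != 0.
  by apply: contraNneq x0; rewrite xE => ->; rewrite mulr0.
move: (z0); rewrite tofrac_eq0 => /padic_int_decomp[n [u uu zE]].
have xn : has_padic_val x n.+1.
  by exists u => //; rewrite xE zE rmorphM rmorphXn rmorph_nat mulrA -exprS.
by rewrite (has_padic_val_inj xk xn).
Qed.

Lemma has_padic_val_digit (b : nat) y : (0 < b < p)%N -> pZp p_pr y ->
  has_padic_val (b%:R + y) 0.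
Proof.
move=> /andP[b0 bp] /pZpP[z ->]; exists (b%:R + p%:R * z); last first.
  by rewrite expr0z mul1r rmorphD rmorphM !rmorph_nat.
rewrite padic_int_unitE.
have -> : (b%:R + p%:R * z : Zp) 1%N =
  (((b%:R : Zp) 1%N + ((p%:R : Zp) 1%N * z 1%N) %% p ^ 1) %% p ^ 1)%N by [].
by rewrite !padic_res_nat expn1 modnn mul0n mod0n addn0 modn_mod modn_small// -lt0n.
Qed.

End PadicValuation.

(** * The Schneider map and its continued fractions *)

(** This identity turns the error of a continued fraction into the error of its
    tail. *)
Lemma frac_subr (F : fieldType) (c b y z : F) : b + y != 0 -> b + z != 0 ->
  c / (b + y) - c / (b + z) = - (c * (y - z) * ((b + y)^-1 * (b + z)^-1)).
Proof. by move=> by0 bz0; field; rewrite by0 bz0. Qed.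

Section SchneiderMap.
Context {p : nat} {p_pr : prime p}.
Local Notation Zp := (padic_int p_pr).
Local Notation Qp := (padic p_pr).
Local Notation tofrac := (@FracField.tofrac Zp).
Local Notation T := (@schneider p p_pr).
Implicit Types x : Qp.

(** The digit exists because p ^ a1 / x is a unit of Z_p: its residue modulo p
    is the required b.  The last equation is the definition of T solved
    for x. *)
Lemma schneider_stepP x : pZp p_pr x -> x != 0 ->
  [/\ has_padic_val x (schneider_a1 x), (0 < schneider_b1 x < p)%N,
      pZp p_pr (schneider x)
    & x = p%:R ^ schneider_a1 x / ((schneider_b1 x)%:R + schneider x)].
Proof.
move=> xpZ x0; have [k xk] := has_padic_val_ex x0.
have xa : has_padic_val x (schneider_a1 x).
  by rewrite /schneider_a1 (padic_valE xk).
have [w wu wE] : has_padic_val (p%:R ^ schneider_a1 x / x) 0.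
  rewrite -(subrr (schneider_a1 x)).
  exact/has_padic_valM/has_padic_valV/xa/has_padic_valX.
move: wE; rewrite expr0z mul1r => wE.
have w1 : (0 < w 1%N < p)%N.
  by rewrite lt0n -padic_int_unitE wu -[X in (_ < X)%N]expn1 padic_res_ltn.
(* xget returns its default value only if no digit fits, and w 1 fits. *)
have [b0 bpZ] : (1 <= schneider_b1 x <= p.-1)%N /\
    pZp p_pr ((schneider_b1 x)%:R - p%:R ^ schneider_a1 x / x).
  rewrite /schneider_b1; case: xgetP => [b _|/(_ (w 1%N)) []]; first exact.
  split; first by case/andP: w1 => -> /= ?; rewrite -ltnS prednK ?prime_gt0.
  (* The unit w minus its residue vanishes modulo p, hence is divisible by p. *)
  have [|z zE _] := @padic_res1_divp p p_pr ((w 1%N)%:R - w) _.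
    by apply: padic_resB0; rewrite padic_res_nat padic_res_modn.
  have := congr1 tofrac zE; rewrite rmorphB rmorphM !rmorph_nat => wzE.
  by apply/pZpP; exists z; rewrite wE -wzE.
have TE : schneider x = p%:R ^ schneider_a1 x / x - (schneider_b1 x)%:R.
  by rewrite /schneider (negbTE x0).
split=> //.
- case/andP: b0 => -> /= b_lt.
  by rewrite (leq_ltn_trans b_lt)// ltn_predL prime_gt0.
- rewrite TE -opprB; case/pZpP: bpZ => z ->; apply/pZpP; exists (- z).
  by rewrite rmorphN mulrN.
- by rewrite TE addrC subrK invf_div mulrCA divff ?mulr1// expfz_neq0// padic_p_neq0.
Qed.

(** Off F no iterate vanishes, so every step of the orbit is a genuine
    continued fraction step. *)
Lemma schneider_F_orbit x : (pZp p_pr `\` schneider_F p_pr) x ->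
  forall i, pZp p_pr (iter i T x) /\ iter i T x != 0.
Proof.
move=> [xpZ xF] i; have x0 j : iter j T x != 0.
  by apply/eqP => xj; apply: xF; split=> //; exists j.
by split=> //; elim: i => //= i IH; case: (schneider_stepP IH (x0 i)).
Qed.

Section Orbit.
Variable x : Qp.
Hypothesis x_orbit :
  forall i, pZp p_pr (iter i T x) /\ iter i T x != 0.

Lemma schneider_frac_pZp i m : pZp p_pr (schneider_frac x i.+1 m).
Proof.
elim: m i => [|m IH] i /=; first by apply/pZpP; exists 0; rewrite rmorph0 mulr0.
have [xpZ x0] := x_orbit i; have [xa bp _ _] := schneider_stepP xpZ x0.
have fa := has_padic_valM (has_padic_valX (schneider_a x i.+1))
  (has_padic_valV (has_padic_val_digit bp (IH i.+1))).
by move: fa; rewrite oppr0 addr0 => /pZp_val ->; apply/(pZp_val xa).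
Qed.

(** The error of the m-level fraction involves m + 1 digits: one factor p ^ a
    per level, and the valuation of the truncated tail. *)
Lemma schneider_frac_err i m :
  has_padic_val (iter i T x - schneider_frac x i.+1 m)
    (\sum_(i.+1 <= j < (i + m).+2) schneider_a x j).
Proof.
elim: m i => [|m IH] i.
  have [xpZ x0] := x_orbit i; have [xa _ _ _] := schneider_stepP xpZ x0.
  by rewrite /= subr0 addn0 big_nat1.
have [xpZ x0] := x_orbit i; have [_ bp TpZ xE] := schneider_stepP xpZ x0.
have ux := has_padic_val_digit bp TpZ.
have uf := has_padic_val_digit bp (schneider_frac_pZp i.+1 m).
have /has_padic_valN := has_padic_valM (has_padic_valM
  (has_padic_valX (schneider_a x i.+1)) (IH i.+1))
  (has_padic_valM (has_padic_valV ux) (has_padic_valV uf)).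
rewrite !oppr0 !addr0 -addSnnS (@big_ltn _ _ _ i.+1); last first.
  by rewrite !ltnS addSn ltnW// ltnS leq_addr.
have [ux0 uf0] := (has_padic_val_neq0 ux, has_padic_val_neq0 uf).
rewrite /=; congr has_padic_val; rewrite [in RHS]xE.
rewrite -[schneider_a x i.+1]/(schneider_a1 _) -[schneider_b x i.+1]/(schneider_b1 _).
by rewrite frac_subr.
Qed.

End Orbit.

End SchneiderMap.

(** * Comparison of the limits *)

Section SuccRatio.
Import numFieldNormedType.Exports.

Lemma cvg_succ_ratio (R : realType) :
  (fun n => n.+1%:R / n%:R : R) @ \oo --> (1 : R).
Proof.
have succE : (fun n => 1 + harmonic n) = (fun n => n.+2%:R / n.+1%:R : R).
  by apply/funext => n; rewrite -natr1 mulrDl divff// mul1r.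
rewrite -cvg_shiftS -[X in X @ _]succE.
have := cvgD (@cvg_cst R 1 nat \oo _) (@cvg_harmonic R).
by rewrite addr0; exact.
Qed.

End SuccRatio.

Theorem mainTheorem4 (R : realType) (p : nat) (p_pr : prime p) (x : padic p_pr)
  (xpZp : (pZp p_pr `\` schneider_F p_pr) x) (xlyap : has_lyapunov R x) :
  let u (n : nat) : \bar R :=
    (n%:R^-1 * ln (ratr (padic_abs (x - schneider_approx x n))))%:E in
  cvgn u /\ lyapunov R x = (- limn u)%E.
Proof.
move=> u.
have uE n : u n = (- ((n.+1%:R / n%:R)%:E * (lyapunov_seq R x n.+1)%:E))%E.
  have /padic_absE := schneider_frac_err (schneider_F_orbit xpZp) 0 n.
  rewrite /u /schneider_approx /= add0n => ->.
  rewrite fmorphXz [X in X ^ _]rmorph_nat -powR_intmul// ln_powR rmorphN /=.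
  rewrite /lyapunov_seq; congr EFin; move: (_%:~R) => S.
  have n1 : n.+1%:R != 0 :> R by rewrite pnatr_eq0.
  (* With 1 / n abstracted into c, the identity covers n = 0 as well. *)
  by move: (n%:R^-1) => c; field.
have Lcvg : (lyapunov_seq R x n.+1)%:E @[n --> \oo] --> lyapunov R x.
  by rewrite (cvg_shiftS (fun n => (lyapunov_seq R x n)%:E)); exact: xlyap.
have ucvg : u n @[n --> \oo] --> (- lyapunov R x)%E.
  have -> : u = (fun n =>
      - ((n.+1%:R / n%:R)%:E * (lyapunov_seq R x n.+1)%:E))%E by exact/funext.
  rewrite -[X in _ --> (- X)%E]mul1e; apply: cvgeN; apply: cvgeM => //.
    (* A nonzero real may multiply an infinite limit. *)
    by rewrite /mule_def oner_neq0; case: lyapunov.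
  apply: cvg_EFin; first exact: nearW.
  exact: cvg_succ_ratio.
split; first by apply/cvg_ex; exists (- lyapunov R x)%E.
by rewrite (cvg_lim _ ucvg)// oppeK.
Qed.
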